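(* For all integers $n\geq 0$ and $k\geq 0$, \[ b\left(3^{2(k+1)}n+\frac{5\cdot 3^{2(k+1)}+3}{8}\right)\equiv (-1)^k\, b(9n+6)\pmod{3}, \] and for all integers $n\geq 0$, \[ b(81n+24)\equiv -\,b(9n+3)\pmod{3}. \]
   Context: For $m\in\mathbb{N}$ and $|q|<1$ let $f_m:=\prod_{n\geq 1}(1-q^{mn})$. Let $b(n)$ denote the number of partition triples $(\pi_1,\pi_2,\pi_3)$ of $n$ (i.e. $\pi_1,\pi_2,\pi_3$ are partitions whose sizes sum to $n$) such that $\pi_1$ consists of distinct odd parts and $\pi_2$ and $\pi_3$ consist of parts divisible by $4$, with $b(0)=1$. Equivalently, $\sum_{n\geq 0} b(n)q^n = \dfrac{f_2^2}{f_1f_4^3}$. *)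

(* Defs.v *)
From mathcomp Require Import all_boot all_order all_algebra.
Set Implicit Arguments. Unset Strict Implicit. Unset Printing Implicit Defensive.
Import GRing.Theory Num.Theory.
Local Open Scope ring_scope.

(* f_m = prod_{i>=1} (1 - q^{m i}), truncated to the factors i = 1..N
   (exact modulo q^{N+1}). *)
Definition f_trunc (m N : nat) : {poly int} :=
  \prod_(1 <= i < N.+1) (1 - 'X^(m * i)).

(* 1/(1 - q^e) expanded as a geometric series, truncated at j = N. *)
Definition geom_trunc (e N : nat) : {poly int} :=
  \sum_(j < N.+1) 'X^(e * j).

(* 1/f_m = prod_{i>=1} 1/(1 - q^{m i}), truncated (exact modulo q^{N+1}). *)
Definition finv_trunc (m N : nat) : {poly int} :=
  \prod_(1 <= i < N.+1) geom_trunc (m * i) N.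

(* b(n) = coefficient of q^n in f_2^2 / (f_1 f_4^3). All truncations above are
   exact up to degree n, so this is the true coefficient. *)
Definition b (n : nat) : int :=
  (f_trunc 2 n ^+ 2 * finv_trunc 1 n * finv_trunc 4 n ^+ 3)`_n.

(* Main.v *)
(** Put [f_m] for the Euler product, [x = f_1], [y = f_2], [z = f_4], and work
    modulo 3, where cubing is the substitution [q -> q^3].  The triple product
    writes [psi(q) = y^2/x] and [A(q) = f_2 f_3^2/(f_1 f_6)] as theta series,
    and sorting triangular numbers modulo 3 gives
    [psi(q) = A(q^3) + q psi(q^9)], which modulo 3 is the single relation
    [x^8 y^8 = x^24 + q y^24].  Read at [q], [-q] and [q^2], it provides the
    3-dissections of [psi(q)], [psi(-q)], [psi(q^2)] and [phi(-q)], from which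
    the subseries [b(3n)], [b(9n+3)], [b(9n+6)], [b(27n+24)], [b(81n+51)] and
    [b(81n+24)] are successively read off as eta quotients.

    Instead of power series, all identities are proved in a commutative ring
    where [q] is nilpotent, and instantiated in ['F_3[X]/(X^(D+1))]: infinite
    products and theta series are then finite, and [f_m] is invertible. *)

Require Import Defs.
From mathcomp Require Import all_boot all_order all_algebra.
From mathcomp Require Import zify ring.
Set Implicit Arguments. Unset Strict Implicit. Unset Printing Implicit Defensive.
Import GRing.Theory Num.Theory.
Local Open Scope ring_scope.

(** * The finite triple product *)

Section QBinomial.
Variables (R : comNzRingType) (Q : R).

(** A finite q-Pochhammer symbol: at [u] = q^m, [c = -1] gives f_m and [c = 1] gives f_{2m}/f_m. *)
Definition eprod (c u : R) (n : nat) : R := \prod_(i < n) (1 + c * u ^+ i.+1).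

Lemma eprodS c u n : eprod c u n.+1 = eprod c u n * (1 + c * u ^+ n.+1).
Proof. by rewrite /eprod big_ord_recr. Qed.

(** Gaussian binomials, defined by a Pascal rule since [R] has no division by [1 - Q ^+ i]. *)
Fixpoint qbin (n k : nat) : R :=
  match n, k with
  | _, 0 => 1
  | 0, _.+1 => 0
  | n'.+1, k'.+1 => qbin n' k'.+1 + Q ^+ (n' - k') * qbin n' k'
  end.

Arguments qbin : simpl never.

Lemma qbinS n k : qbin n.+1 k.+1 = qbin n k.+1 + Q ^+ (n - k) * qbin n k.
Proof. by []. Qed.

Lemma qbin0 n : qbin n 0 = 1.
Proof. by case: n. Qed.

Lemma qbin_small n k : (n < k)%N -> qbin n k = 0.
Proof.
elim: n k => [|n IHn] [|k] // lt_nk; rewrite qbinS.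
by rewrite !IHn ?mulr0 ?addr0 //; lia.
Qed.

Lemma qbinSr n k : qbin n.+1 k.+1 = Q ^+ k.+1 * qbin n k.+1 + qbin n k.
Proof.
elim: n k => [|n IHn] k.
  by rewrite qbinS sub0n expr0 mul1r mulr0.
rewrite qbinS [qbin n.+1 k.+1 in RHS]qbinS.
case: (ltngtP k n.+1) => [lt_k|gt_k|->]; last first.
- by rewrite subnn (@qbin_small n n.+2) // (@qbin_small n n.+1) // (@qbin_small n.+1 n.+2) //; ring.
- by rewrite !qbin_small ?mulr0 ?addr0 ?mulr0 //; lia.
rewrite {1}IHn.
have -> : (n.+1 - k = (n - k).+1)%N by lia.
case: k lt_k => [|k] lt_k.
  by rewrite !qbin0 subn0 !exprS; ring.
rewrite [in X in _ + X]IHn [qbin n.+1 k.+1 in RHS]qbinS.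
have -> : (n - k = (n - k.+1).+1)%N by lia.
rewrite !exprS; ring.
Qed.

(** The quotient formula with denominators cleared. The induction splits 1 - Q^(n+1) as (1 -
    Q^(n-k)) + Q^(n-k) (1 - Q^(k+1)). *)
Lemma qbin_eprod n k : (k <= n)%N ->
  qbin n k * (eprod (-1) Q k * eprod (-1) Q (n - k)) = eprod (-1) Q n.
Proof.
elim: n k => [|n IHn] [|k] le_kn.
- by rewrite /= /eprod !big_ord0 !mulr1.
- by [].
- by rewrite qbin0 /eprod big_ord0 !mul1r.
rewrite subSS qbinS !(eprodS _ _ n) !(eprodS _ _ k); case: (ltnP k n) => [lt_kn|ge_kn]; last first.
  have -> : k = n by lia.
  rewrite subnn expr0 mul1r qbin_small // add0r -[in RHS](IHn n) // subnn; ring.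
have IH1 := IHn _ lt_kn; have IH2 := IHn _ (ltnW lt_kn).
rewrite mulrDl -[in X in X + _](subnSK lt_kn) eprodS (subnSK lt_kn).
transitivity (eprod (-1) Q n * (1 - Q ^+ (n - k)) +
   Q ^+ (n - k) * eprod (-1) Q n * (1 - Q ^+ k.+1)).
  by rewrite -{1}IH1 -IH2 !eprodS; ring.
have -> : Q ^+ n.+1 = Q ^+ (n - k) * Q ^+ k.+1.
  by rewrite -exprD; congr (_ ^+ _); lia.
ring.
Qed.

(* The j-th term of the bilateral theta series, with index j = k - N. *)
Definition theta_term (x y : R) (N k : nat) : R :=
  if (N <= k)%N then Q ^+ 'C(k - N, 2) * x ^+ (k - N)
  else Q ^+ 'C(N - k, 2) * y ^+ (N - k).

Lemma qbinomial_theorem (y : R) n :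
  \prod_(i < n) (1 + y * Q ^+ i) =
  \sum_(k < n.+1) qbin n k * (Q ^+ 'C(n - k, 2) * y ^+ (n - k)).
Proof.
elim: n => [|n IHn]; first by rewrite big_ord0 big_ord1 /= !mulr1.
rewrite big_ord_recr /= {}IHn mulrDr mulr1 [RHS]big_ord_recl /= qbin0 mul1r.
under [in RHS]eq_bigr => i _ do
  rewrite /bump /= add1n subSS qbinSr mulrDl.
rewrite big_split /= addrA [RHS]addrC; congr (_ + _).
rewrite [in RHS]big_ord_recr /= qbin_small // mulr0 mul0r addr0.
rewrite mulr_suml big_ord_recl /= qbin0 mul1r subn0; congr (_ + _).
  by rewrite binS bin1 exprD exprS; ring.
apply: eq_bigr => i _; rewrite /bump /= add1n.
have -> : (n - i = (n - i.+1).+1)%N by case: i => i /=; lia.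
rewrite binS bin1 exprD.
have -> : Q ^+ n = Q ^+ i.+1 * Q ^+ (n - i.+1).
  by rewrite -exprD; congr (_ ^+ _); case: i => i /=; lia.
rewrite !exprS; ring.
Qed.

(** Induction on [M] from the q-binomial theorem: the new factor [1 + x * Q ^+ M] shifts the theta
    index by one, with exactly the weight of the Pascal rule [qbinS]. *)
Lemma finite_jacobi_triple (x y : R) (M N : nat) : x * y = Q ->
  \prod_(i < M) (1 + x * Q ^+ i) * \prod_(i < N) (1 + y * Q ^+ i) =
  \sum_(k < (M + N).+1) qbin (M + N) k * theta_term x y N k.
Proof.
move=> xyQ; elim: M => [|M IHM].
  rewrite big_ord0 mul1r add0n qbinomial_theorem.
  apply: eq_bigr => k _; rewrite /theta_term; case: ifP => // le_Nk.
  have -> : k = N :> nat by case: k le_Nk => k /=; lia.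
  by rewrite subnn.
have step k : (k <= M + N)%N -> theta_term x y N k * (x * Q ^+ M) =
    Q ^+ (M + N - k) * theta_term x y N k.+1.
  move=> le_k; rewrite /theta_term; case: (leqP N k) => [le_Nk|lt_kN].
    rewrite leqW // subSn // binS bin1 exprD.
    have -> : Q ^+ M = Q ^+ (M + N - k) * Q ^+ (k - N).
      by rewrite -exprD; congr (_ ^+ _); lia.
    by rewrite exprS; ring.
  have -> : Q ^+ (M + N - k) = Q ^+ M * Q ^+ (N - k).
    by rewrite -exprD; congr (_ ^+ _); lia.
  have -> : (N - k = (N - k.+1).+1)%N by lia.
  rewrite binS bin1 exprD; case: (leqP N k.+1) => [le_N|lt_N].
    (* Here [k.+1 = N]: the shift crosses from index -1 to index 0, and [x * y = Q] absorbs the last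
       [y]. *)
    have -> : (k.+1 - N = 0)%N by lia.
    have -> : (N - k.+1 = 0)%N by lia.
    by rewrite -xyQ; ring.
  by rewrite !exprS -xyQ; ring.
rewrite addSn big_ord_recr /= [_ * (1 + _)]mulrC -mulrA {}IHM mulrDl mul1r.
rewrite [in X in _ + X = _]mulr_sumr [RHS]big_ord_recl /= qbin0 mul1r.
under [in RHS]eq_bigr => k _ do
  rewrite /bump /= add1n qbinS mulrDl.
rewrite big_split /= addrA; congr (_ + _).
  rewrite [in RHS]big_ord_recr /= qbin_small // mul0r addr0.
  rewrite big_ord_recl /= qbin0 mul1r; congr (_ + _).
apply: eq_bigr => k _; rewrite mulrCA [X in _ * X]mulrC step; last by case: k.
ring.
Qed.
End QBinomial.

(** * Theta series at a nilpotent argument *)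

Section Nilpotent.
Variables (R : comNzRingType) (D : nat).

Lemma expr_nil (u : R) n : u ^+ D.+1 = 0 -> (D < n)%N -> u ^+ n = 0.
Proof. by move=> uD lt_Dn; rewrite -(subnKC lt_Dn) exprD uD mul0r. Qed.

Lemma expr_nilX (u : R) m : u ^+ D.+1 = 0 -> (u ^+ m.+1) ^+ D.+1 = 0.
Proof. by move=> uD; rewrite -exprM mulnC exprM uD expr0n. Qed.

Lemma sum_ord_stable (F : nat -> R) m n : (m <= n)%N ->
  (forall i, (m <= i)%N -> F i = 0) -> \sum_(i < n) F i = \sum_(i < m) F i.
Proof.
move=> /subnKC <- F0; elim: (n - m)%N => [|k IHk]; first by rewrite addn0.
by rewrite addnS big_ord_recr /= IHk F0 ?addr0 // leq_addr.
Qed.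

Lemma eprod_stable (c u : R) n : u ^+ D.+1 = 0 -> (D <= n)%N ->
  eprod c u n = eprod c u D.
Proof.
move=> uD /subnKC <-; elim: (n - D)%N => [|k IHk]; first by rewrite addn0.
rewrite addnS eprodS IHk (expr_nil uD) ?mulr0 ?addr0 ?mulr1 //; lia.
Qed.

Lemma eprod_inv (u : R) n : u ^+ D.+1 = 0 ->
  eprod (-1) u n * \prod_(i < n) \sum_(j < D.+1) (u ^+ i.+1) ^+ j = 1.
Proof.
move=> uD; rewrite /eprod -big_split /= big1 // => i _.
rewrite mulN1r; apply: oppr_inj.
by rewrite -mulNr opprB -subrX1 expr_nilX // sub0r.
Qed.

Lemma eprod_rreg (u : R) n a b : u ^+ D.+1 = 0 ->
  a * eprod (-1) u n = b * eprod (-1) u n -> a = b.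
Proof.
move=> uD eq_ab; have f1 := eprod_inv n uD.
by rewrite -[a]mulr1 -[b]mulr1 -f1 !mulrA eq_ab.
Qed.

(** Once [k] and [n - k] reach [D], all three products in [qbin_eprod] equal [eprod (-1) Q D], and
    one of them cancels. *)
Lemma eprod_qbin (Q : R) n k : Q ^+ D.+1 = 0 -> (D <= k)%N -> (k + D <= n)%N ->
  eprod (-1) Q D * qbin Q n k = 1.
Proof.
move=> QD le_Dk le_n; apply: (eprod_rreg (n := D) QD).
have := qbin_eprod Q (_ : k <= n)%N; rewrite 3?(eprod_stable _ QD); try lia.
by move=> E; rewrite mul1r -[RHS]E; [ring | lia].
Qed.

Lemma bin2_gt j : (D.+2 <= j)%N -> (D < 'C(j, 2))%N.
Proof. by case: j => [|j] // ltDj; rewrite binS bin1; lia. Qed.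

(** The limit of the finite identity with [M = N]. The lengths [J] and [K] are free because the
    theta terms vanish beyond the stated bounds. *)
Lemma jacobi_triple_nil (Q x y : R) N J K : x * y = Q -> Q ^+ D.+1 = 0 ->
  (D.*2.+2 <= N)%N -> (D.+2 <= J)%N -> (D.+1 <= K)%N ->
  eprod (-1) Q D *
    (\prod_(i < N) (1 + x * Q ^+ i) * \prod_(i < N) (1 + y * Q ^+ i)) =
  \sum_(j < J) Q ^+ 'C(j, 2) * x ^+ j +
  \sum_(j < K) Q ^+ 'C(j.+1, 2) * y ^+ j.+1.
Proof.
move=> xyQ QD le_N le_J le_K; rewrite finite_jacobi_triple // mulr_sumr.
rewrite -(big_mkord xpredT
  (fun k => eprod (-1) Q D * (qbin Q (N + N) k * theta_term Q x y N k))).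
rewrite (big_cat_nat (n := N)) //=; last by lia.
rewrite addrC; congr (_ + _).
  rewrite -{1}[N]add0n big_addn subSn ?leq_addr // addnK big_mkord.
  transitivity (\sum_(j < N.+1) Q ^+ 'C(j, 2) * x ^+ j).
    apply: eq_bigr => -[j /= lt_j] _; rewrite /theta_term leq_addl addnK.
    (* Near the centre the binomial cancels the product; farther out [N >= 2 D + 2] forces
       [j >= D + 2], so the power of [Q] is already zero. *)
    case: (leqP (j + D) N) => cmp.
      by rewrite mulrA eprod_qbin ?mul1r //; lia.
    by rewrite (expr_nil QD) ?mul0r ?mulr0 //; apply: bin2_gt; lia.
  have z i : (D.+2 <= i)%N -> Q ^+ 'C(i, 2) * x ^+ i = 0.
    by move=> /bin2_gt/(expr_nil QD)->; rewrite mul0r.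
  have S n := @sum_ord_stable (fun j => Q ^+ 'C(j, 2) * x ^+ j) D.+2 n ^~ z.
  by rewrite (S N.+1) ?(S J) //; lia.
rewrite big_nat_rev big_mkord add0n.
transitivity (\sum_(j < N) Q ^+ 'C(j.+1, 2) * y ^+ j.+1).
  apply: eq_bigr => -[j /= lt_j] _; rewrite /theta_term.
  have -> : (N <= N - j.+1)%N = false by lia.
  have -> : (N - (N - j.+1) = j.+1)%N by lia.
  case: (leqP (j.+1 + D) N) => cmp.
    by rewrite mulrA eprod_qbin ?mul1r //; lia.
  by rewrite (expr_nil QD) ?mul0r ?mulr0 //; apply: bin2_gt; lia.
have z i : (D.+1 <= i)%N -> Q ^+ 'C(i.+1, 2) * y ^+ i.+1 = 0.
  by move=> le_i; rewrite (expr_nil QD) ?mul0r //; apply: bin2_gt.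
have S n := @sum_ord_stable (fun j => Q ^+ 'C(j.+1, 2) * y ^+ j.+1) D.+1 n ^~ z.
by rewrite (S N) ?(S K) //; lia.
Qed.

Lemma eprod_double (u : R) n :
  eprod 1 u n * eprod (-1) u n = eprod (-1) (u ^+ 2) n.
Proof.
rewrite /eprod -big_split /=; apply: eq_bigr => i _.
by rewrite -exprM mulnC exprM; ring.
Qed.

Lemma eprod_parity (c u : R) n : eprod c u n.*2 =
  \prod_(i < n) (1 + c * u ^+ i.*2.+1) * eprod c (u ^+ 2) n.
Proof.
elim: n => [|n IHn]; first by rewrite /eprod !big_ord0 mulr1.
rewrite doubleS !eprodS IHn big_ord_recr /= -exprM mul2n doubleS; ring.
Qed.

(** That is, f_1(-q) = f_2^3/(f_1 f_4): the odd-index factors at [u] and [- u] multiply to those at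
    [u ^+ 2]. *)
Lemma eprodN (u : R) : u ^+ D.+1 = 0 ->
  eprod (-1) (- u) D * eprod (-1) u D * eprod (-1) (u ^+ 4) D =
  eprod (-1) (u ^+ 2) D ^+ 3.
Proof.
move=> uD; have NuD : (- u) ^+ D.+1 = 0 by rewrite exprNn uD mulr0.
have u2D : (u ^+ 2) ^+ D.+1 = 0 by apply: expr_nilX.
have leD : (D <= D.*2)%N by lia.
have E1 := eprod_parity (-1) u D; have E2 := eprod_parity (-1) (- u) D.
have E3 := eprod_parity (-1) (u ^+ 2) D.
rewrite (eprod_stable _ _ leD) // in E1; rewrite (eprod_stable _ _ leD) // in E2.
rewrite (eprod_stable _ _ leD) // -exprM -[(2 * 2)%N]/4%N in E3.
have E4 : \prod_(i < D) (1 + -1 * (- u) ^+ i.*2.+1) *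
    \prod_(i < D) (1 + -1 * u ^+ i.*2.+1) =
    \prod_(i < D) (1 + -1 * (u ^+ 2) ^+ i.*2.+1).
  rewrite -big_split /=; apply: eq_bigr => i _.
  rewrite exprNn -signr_odd /= odd_double /= -exprM mulnC exprM; ring.
rewrite sqrrN in E2; rewrite E1 E2.
set y := eprod (-1) (u ^+ 2) D in E3 *.
by rewrite [RHS]exprS [X in _ = X * _]E3 -E4; ring.
Qed.

(** * Theta series in characteristic 3 *)

Hypothesis char3 : 3%N \in [pchar R].

Lemma eprod_cube (c u : R) n : eprod c u n ^+ 3 = eprod (c ^+ 3) (u ^+ 3) n.
Proof.
rewrite /eprod -prodrXl; apply: eq_bigr => i _.
rewrite -[LHS](pFrobenius_autE char3) rmorphD rmorph1 /= pFrobenius_autE.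
by rewrite exprMn -!exprM mulnC.
Qed.

Lemma sum_cube n (F : 'I_n -> R) :
  (\sum_(i < n) F i) ^+ 3 = \sum_(i < n) F i ^+ 3.
Proof. by rewrite -[LHS](pFrobenius_autE char3) rmorph_sum. Qed.

Lemma cubeD (a b : R) : (a + b) ^+ 3 = a ^+ 3 + b ^+ 3.
Proof. by rewrite -[LHS](pFrobenius_autE char3) rmorphD. Qed.

Let three0 : 3%:R = 0 :> R.
Proof. exact: pcharf0. Qed.

Definition tri_sum (u : R) n := \sum_(j < n) u ^+ 'C(j.+1, 2).

(** The triple product at [x = u], [y = 1]. The factor [1 + u ^+ 0] and the two equal halves of the
    series make both sides double; the 2 is removed as -1. *)
Lemma gauss_triangular (u : R) n : u ^+ D.+1 = 0 -> (D.+1 <= n)%N ->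
  tri_sum u n = eprod (-1) u D * eprod 1 u D ^+ 2.
Proof.
move=> uD lt_n.
have := jacobi_triple_nil (mulr1 u) uD (leqnn _) (leqnn _) lt_n.
under eq_bigr do rewrite -exprS -[u ^+ _]mul1r.
rewrite -/(eprod 1 u _) (eprod_stable _ uD); last by lia.
rewrite big_ord_recl /=.
under eq_bigr do rewrite /bump /= add1n.
rewrite -/(eprod 1 u _) (eprod_stable _ uD); last by lia.
under [X in _ = X + _]eq_bigr => j _ do rewrite -exprD addnC -[j in (j + _)%N]bin1 addnC -binS.
under [X in _ = _ + X]eq_bigr => j _ do rewrite expr1n mulr1.
have z i : (D.+1 <= i)%N -> u ^+ 'C(i.+1, 2) = 0.
  by move=> le_i; rewrite (expr_nil uD) //; apply: bin2_gt.
have S n' := @sum_ord_stable (fun j => u ^+ 'C(j.+1, 2)) D.+1 n' ^~ z.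
rewrite (S D.+2) // -(S n) // -/(tri_sum u n) expr0 => E.
have -> : tri_sum u n = 3%:R * tri_sum u n - (tri_sum u n + tri_sum u n) by ring.
rewrite -E three0 mul0r sub0r.
set f := eprod (-1) u D; set g := eprod 1 u D.
by rewrite -[RHS]subr0 -(mul0r (f * g ^+ 2)) -three0; ring.
Qed.

(* The bilateral series of u^(j (3 j + 1) / 2), split into j >= 0 and j < 0. *)
Definition pent_sum (u : R) n :=
  \sum_(j < n) u ^+ (3 * 'C(j, 2) + 2 * j) +
  \sum_(j < n) u ^+ (3 * 'C(j.+1, 2) + j.+1).

(** The triple product at [Q = u ^+ 3], [x = u ^+ 2], [y = u]. Multiplying by [eprod 1 (u ^+ 3)], a
    cube, supplies the missing residue class and completes [eprod 1 u]. *)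
Lemma pent_sum_prod (u : R) n : u ^+ D.+1 = 0 -> (D.+2 <= n)%N ->
  pent_sum u n * eprod 1 u D ^+ 3 = eprod (-1) u D ^+ 3 * eprod 1 u D.
Proof.
move=> uD lt_n; set N := D.*2.+2.
have u3D : (u ^+ 3) ^+ D.+1 = 0 by apply: expr_nilX.
have := jacobi_triple_nil (esym (exprSr u 2)) u3D (leqnn N) lt_n (ltnW lt_n).
under [X in _ = X + _]eq_bigr => j _ do rewrite -!exprM -exprD.
under [X in _ = _ + X]eq_bigr => j _ do rewrite -exprM -exprD.
rewrite -/(pent_sum u n) => <-; rewrite !eprod_cube expr1n.
have -> : (-1) ^+ 3 = -1 :> R by ring.
rewrite -mulrA; congr (_ * _); rewrite -(eprod_stable 1 u3D (_ : D <= N)%N).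
  rewrite -(eprod_stable 1 uD (_ : D <= 3 * N)%N); last by lia.
  elim: N => [|k IHk]; first by rewrite muln0 /eprod !big_ord0 !mulr1.
  rewrite !big_ord_recr /= mulnS !addSn add0n !eprodS -IHk (exprS _ k) -!exprM.
  by rewrite (exprS u (3 * k).+2) (exprS u (3 * k).+1) (exprS u (3 * k)); ring.
by lia.
Qed.

(** Indices 3n and 3n+2 give exponents divisible by 3 and form the two halves of [pent_sum]; index
    3n+1 gives 9 'C(n+1, 2) + 1. Frobenius turns the sums into powers. *)
Lemma tri_sum_dissect (u : R) n :
  tri_sum u (3 * n) = pent_sum u n ^+ 3 + u * tri_sum u n ^+ 9.
Proof.
rewrite /pent_sum cubeD -[9%N]/(3 * 3)%N exprM /tri_sum !sum_cube.
elim: n => [|n IHn]; first by rewrite muln0 !big_ord0 mulr0 !addr0.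
rewrite mulnS !addSn add0n 3!big_ord_recr /= {}IHn !big_ord_recr /= -!exprM.
have -> : ('C((3 * n).+1, 2) = (3 * 'C(n, 2) + 2 * n) * 3)%N.
  by elim: n => // n IHn; rewrite mulnS !addSn add0n; rewrite !binS ?bin1 ?bin0 in IHn *; lia.
have -> : ('C((3 * n).+2, 2) = ('C(n.+1, 2) * 3 * 3).+1)%N.
  by elim: n => // n IHn; rewrite mulnS !addSn add0n; rewrite !binS ?bin1 ?bin0 in IHn *; lia.
have -> : ('C((3 * n).+3, 2) = (3 * 'C(n.+1, 2) + n.+1) * 3)%N.
  by elim: n => // n IHn; rewrite mulnS !addSn add0n; rewrite !binS ?bin1 ?bin0 in IHn *; lia.
rewrite exprS !mulnA; ring.
Qed.

Lemma eprod_mod3 (u : R) : u ^+ D.+1 = 0 ->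
  eprod (-1) u D ^+ 8 * eprod (-1) (u ^+ 2) D ^+ 8 =
  eprod (-1) u D ^+ 24 + u * eprod (-1) (u ^+ 2) D ^+ 24.
Proof.
move=> uD; set x := eprod _ u D; set y := eprod _ _ D; set g := eprod 1 u D.
have gx : g * x = y by apply: eprod_double.
have u2D : (u ^+ 2) ^+ D.+1 = 0 by apply: expr_nilX.
have := tri_sum_dissect u D.+2; rewrite !gauss_triangular //; try lia.
have := pent_sum_prod uD (leqnn _); set A := pent_sum _ _; rewrite -/x -/g => Ag E.
have Ag2 : A * g ^+ 2 = x ^+ 3.
  (* Cancelling the regular factor [y = g * x] lowers the powers of [g] in [Ag]. *)
  apply: (eprod_rreg (n := D) u2D); rewrite -/y -gx.
  transitivity (A * g ^+ 3 * x); first by ring.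
  by rewrite Ag; ring.
have Ag6 : A ^+ 3 * g ^+ 6 = x ^+ 9.
  transitivity ((A * g ^+ 2) ^+ 3); first by ring.
  by rewrite Ag2; ring.
(* The dissection of [x * g ^+ 2] is multiplied by [g ^+ 6 * x ^+ 15]. *)
rewrite -gx; transitivity (x * g ^+ 2 * g ^+ 6 * x ^+ 15); first by ring.
rewrite E; transitivity (A ^+ 3 * g ^+ 6 * x ^+ 15 + u * (g * x) ^+ 24); last first.
  by rewrite Ag6; ring.
ring.
Qed.
End Nilpotent.

(** * Dissections modulo 3 *)

Section Dissections.
Variables (R : comNzRingType) (q x y z xi yi zi : R).
Hypothesis char3 : 3%N \in [pchar R].
Hypotheses (xK : x * xi = 1) (yK : y * yi = 1) (zK : z * zi = 1).
(** The relation of [eprod_mod3] at q, q^2 and -q; by [eprodN], [y ^+ 3 * xi * zi] is f_1(-q). *)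
Hypothesis mod3_q : x ^+ 8 * y ^+ 8 = x ^+ 24 + q * y ^+ 24.
Hypothesis mod3_qq : y ^+ 8 * z ^+ 8 = y ^+ 24 + q ^+ 2 * z ^+ 24.
Hypothesis mod3_Nq : (y ^+ 3 * xi * zi) ^+ 8 * y ^+ 8 =
  (y ^+ 3 * xi * zi) ^+ 24 - q * y ^+ 24.

Let three0 : 3%:R = 0 :> R.
Proof. exact: pcharf0. Qed.

(* phi(-q), psi(-q), 1/psi(-q), the image of A under q -> -q, and the cube root
   of (phi(-q) - phi(-q^9))/q. *)
Let phi := x ^+ 2 * yi.
Let w := x * z * yi.
Let wi := y * xi * zi.
Let a := y ^+ 13 * xi ^+ 5 * zi ^+ 5.
Let W := y ^+ 5 * xi ^+ 2.

Let psi_dissect : y ^+ 2 * xi = (x ^+ 5 * yi ^+ 2) ^+ 3 + q * (y ^+ 6 * xi ^+ 3) ^+ 3.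
Proof.
transitivity (xi ^+ 9 * yi ^+ 6 * (x ^+ 8 * y ^+ 8)); first by ring: xK yK.
by rewrite mod3_q; ring: xK yK.
Qed.

Let psi2_dissect :
  z ^+ 2 * yi = (y ^+ 5 * zi ^+ 2) ^+ 3 + q ^+ 2 * (z ^+ 6 * yi ^+ 3) ^+ 3.
Proof.
transitivity (yi ^+ 9 * zi ^+ 6 * (y ^+ 8 * z ^+ 8)); first by ring: yK zK.
by rewrite mod3_qq; ring: yK zK.
Qed.

Let phi_dissect : phi = phi ^+ 9 + q * W ^+ 3.
Proof.
transitivity (xi ^+ 6 * yi ^+ 9 * (x ^+ 8 * y ^+ 8)).
  by rewrite /phi; ring: xK yK.
by rewrite mod3_q /phi /W; ring: xK yK.
Qed.

Let w_dissect : w = a ^+ 3 - q * w ^+ 9.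
Proof.
transitivity (x ^+ 9 * z ^+ 9 * yi ^+ 33 *
    ((y ^+ 3 * xi * zi) ^+ 8 * y ^+ 8)); first by rewrite /w; ring: xK yK zK.
by rewrite mod3_Nq /a /w; ring: xK yK zK.
Qed.

Let wK : w * wi = 1.
Proof. by rewrite /w /wi; ring: xK yK zK. Qed.

Let w2_dissect : w ^+ 2 = a ^+ 6 + q * a ^+ 3 * w ^+ 9 + q ^+ 2 * w ^+ 18.
Proof.
(* The cross term has coefficient -2, which is 1 here. *)
rewrite [in LHS]w_dissect -[RHS]subr0 -(mul0r (q * a ^+ 3 * w ^+ 9)) -three0.
ring.
Qed.

(** As [zi ^+ 3] is a series in q^3, only psi(q) needs dissecting; it has no exponents congruent to
    2. *)
Lemma b_dissect : y ^+ 2 * xi * zi ^+ 3 =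
  (x ^+ 5 * yi ^+ 2 * zi) ^+ 3 + q * (y ^+ 6 * xi ^+ 3 * zi) ^+ 3 +
  q ^+ 2 * 0 ^+ 3.
Proof. by rewrite psi_dissect; ring. Qed.

(** Up to the cubes of [phi] and [wi], the series of b(3n) is [w ^+ 2]. The last two components
    carry b(9n+3) and b(9n+6). *)
Lemma b_3n_dissect : x ^+ 5 * yi ^+ 2 * zi =
  (phi * wi * a ^+ 2) ^+ 3 + q * (phi * a * w ^+ 2) ^+ 3 +
  q ^+ 2 * (phi * w ^+ 5) ^+ 3.
Proof.
have -> : x ^+ 5 * yi ^+ 2 * zi = phi ^+ 3 * wi ^+ 3 * w ^+ 2.
  by rewrite /phi /w /wi; ring: xK yK zK.
rewrite [in LHS]w2_dissect; move: (phi) (w) (wi) (a) wK => phi' w' wi' a' wK'.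
by ring: wK'.
Qed.

(** The dissections of [phi] and [w ^+ 2] are multiplied; their q^3 term joins the first component.
    The last one carries b(27n+24). *)
Lemma b_9n6_dissect : phi * w ^+ 5 =
  (w * (phi ^+ 3 * a ^+ 2 + q * W * w ^+ 6)) ^+ 3 +
  q * (w * (phi ^+ 3 * a * w ^+ 3 + W * a ^+ 2)) ^+ 3 +
  q ^+ 2 * (w * (phi ^+ 3 * w ^+ 6 + W * a * w ^+ 3)) ^+ 3.
Proof.
rewrite !(exprMn _ w) !(cubeD char3).
transitivity (phi * w ^+ 2 * w ^+ 3); first by ring.
by rewrite {1}phi_dissect w2_dissect; ring.
Qed.

(** The summands are cubes times [w] and times psi(q^2). The components for b(81n+24) and b(81n+51)
    are minus the series of b(9n+3) and b(9n+6), whence both congruences. *)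
Lemma b_27n24_dissect : w * (phi ^+ 3 * w ^+ 6 + W * a * w ^+ 3) =
  (- (phi * a * w ^+ 2)) ^+ 3 + q * (- (phi * w ^+ 5)) ^+ 3 +
  q ^+ 2 * (w * y ^+ 6 * xi ^+ 2 * zi ^+ 2 * (z ^+ 6 * yi ^+ 3)) ^+ 3.
Proof.
set c := w * y ^+ 6 * xi ^+ 2 * zi ^+ 2.
(* Both summands contribute [phi * a * w ^+ 2], and 2 = -1. *)
have -> : - (phi * a * w ^+ 2) = phi * w ^+ 2 * a + c * (y ^+ 5 * zi ^+ 2).
  have -> : c * (y ^+ 5 * zi ^+ 2) = phi * a * w ^+ 2.
    by rewrite /c /phi /a /w; ring: xK yK zK.
  by rewrite -[LHS]addr0 -(mul0r (phi * a * w ^+ 2)) -three0; ring.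
transitivity ((phi * w ^+ 2) ^+ 3 * w + c ^+ 3 * (z ^+ 2 * yi)).
  have -> : c ^+ 3 * (z ^+ 2 * yi) = W * a * w * w ^+ 3.
    by rewrite /c /W /a /w; ring: xK yK zK.
  ring.
rewrite psi2_dissect [X in _ * X + _]w_dissect cubeD //; ring.
Qed.
End Dissections.

(** * Coefficients *)

Section CoefModX.
Variables (R : comNzRingType) (D : nat).

Lemma coef_in_qpoly (p r : {poly R}) i :
  in_qpoly ('X^(D.+1)) p = in_qpoly ('X^(D.+1)) r -> (i <= D)%N -> p`_i = r`_i.
Proof.
move=> /(congr1 val) /=; rewrite mk_monic_Xn /= => E le_iD.
have mX := monicXn R D.+1.
rewrite (Pdiv.RingMonic.rdivp_eq mX p) (Pdiv.RingMonic.rdivp_eq mX r) E.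
by rewrite !coefD !coefMXn ltnS le_iD.
Qed.

Lemma in_qpolyX_nil :
  in_qpoly ('X^(D.+1)) 'X ^+ D.+1 = 0 :> {poly %/ ('X^(D.+1) : {poly R})}.
Proof.
rewrite -rmorphXn; apply: val_inj; rewrite /= mk_monic_Xn /=.
by rewrite Pdiv.RingMonic.rmodpp // monicXn.
Qed.
End CoefModX.

(** Over ['F_3] the cube of p is p(X^3), since every constant is its own cube. *)
Lemma coef_cube (p : {poly 'F_3}) n r : (r < 3)%N ->
  (p ^+ 3)`_(3 * n + r) = if r == 0%N then p`_n else 0.
Proof.
move=> lt_r; have ch : 3%N \in [pchar {poly 'F_3}] by rewrite pchar_poly pchar_Fp.
elim/poly_ind: p n => [|p c IHp] n; first by rewrite expr0n !coef0 if_same.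
rewrite cubeD // exprMn -polyC_exp coefD coefMXn coefC coefD coefMX coefC.
have -> : c ^+ 3 = c by case: c => -[|[|[|]]] // ?; apply: val_inj.
case: n => [|n].
  rewrite muln0 add0n lt_r add0r.
  by case: r lt_r {IHp} => [|r] _ //=; rewrite add0r.
have -> : (3 * n.+1 + r < 3)%N = false by lia.
have -> : (3 * n.+1 + r - 3 = 3 * n + r)%N by lia.
by rewrite IHp mulnS !addr0.
Qed.

Lemma coef_dissect D (p A B C : {poly 'F_3}) n :
  in_qpoly ('X^(D.+1)) p =
    in_qpoly ('X^(D.+1)) (A ^+ 3 + 'X * B ^+ 3 + 'X^2 * C ^+ 3) ->
  (3 * n + 2 <= D)%N ->
  [/\ p`_(3 * n) = A`_n, p`_(3 * n + 1) = B`_n & p`_(3 * n + 2) = C`_n].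
Proof.
move=> E le_D.
have c0 (F : {poly 'F_3}) : (F ^+ 3)`_(3 * n) = F`_n.
  by rewrite -[(3 * n)%N]addn0 coef_cube.
have c12 (F : {poly 'F_3}) r : (0 < r < 3)%N -> (F ^+ 3)`_(3 * n + r) = 0.
  by case/andP=> r0 r3; rewrite coef_cube //; case: r r0 r3.
(* The guard [r <= 3 * n] excludes [n = 0], where the subtraction would truncate to the nonzero
   residue class 0. *)
have cm (F : {poly 'F_3}) r : (0 < r < 3)%N -> (r <= 3 * n)%N ->
    (F ^+ 3)`_(3 * n - r) = 0.
  case: n {E c0 c12 le_D} => [|m]; first by case: r.
  move=> /andP[r0 r3] _; have -> : (3 * m.+1 - r = 3 * m + (3 - r))%N by lia.
  by rewrite coef_cube; [case: r r0 r3 => [|[|[|]]] | lia].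
split; rewrite (coef_in_qpoly E) ?coefD ?['X * _]mulrC ?coefMX ?coefXnM; try lia.
- rewrite c0; case: eqP => [_|n0].
    by case: ltnP => [_|le2]; rewrite ?cm // !addr0.
  rewrite -subn1 cm //; last by lia.
  by case: ltnP => [_|le2]; rewrite ?cm // !addr0.
- rewrite c12 // add0r addn1 /= c0; case: ltnP => [_|le2]; first by rewrite addr0.
  have -> : ((3 * n).+1 - 2 = 3 * n - 1)%N by lia.
  by rewrite cm ?addr0 //; lia.
- rewrite c12 // add0r addn2 /= -[(3 * n).+1]addn1 c12 // add0r.
  by rewrite addn1 subSS subSS subn0 c0.
Qed.

(** * Reduction of the truncated generating function modulo 3 *)

Definition b_trunc N : {poly int} :=
  f_trunc 2 N ^+ 2 * finv_trunc 1 N * finv_trunc 4 N ^+ 3.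

Section Truncations.
Variables (R : comNzRingType) (rho : {rmorphism {poly int} -> R}).
Local Notation q := (rho 'X).

Lemma rmorph_f_trunc m N : rho (f_trunc m N) = eprod (-1) (q ^+ m) N.
Proof.
rewrite /f_trunc /eprod big_add1 big_mkord rmorph_prod.
by apply: eq_bigr => i _; rewrite rmorphB rmorph1 rmorphXn exprM mulN1r.
Qed.

Lemma f_truncK D m N : q ^+ D.+1 = 0 -> (D <= N)%N ->
  rho (f_trunc m.+1 N) * rho (finv_trunc m.+1 N) = 1.
Proof.
move=> qD le_DN; have qmN : (q ^+ m.+1) ^+ N.+1 = 0.
  by apply: expr_nilX; apply: (expr_nil qD).
rewrite rmorph_f_trunc -[RHS](eprod_inv N qmN); congr (_ * _).
rewrite /finv_trunc big_add1 big_mkord rmorph_prod; apply: eq_bigr => i _.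
by rewrite rmorph_sum; apply: eq_bigr => j _; rewrite rmorphXn !exprM.
Qed.

Lemma f_trunc_stable D m N : q ^+ D.+1 = 0 -> (D <= N)%N ->
  rho (f_trunc m.+1 N) = rho (f_trunc m.+1 D).
Proof.
by move=> qD le_DN; rewrite !rmorph_f_trunc (eprod_stable _ (expr_nilX _ qD)).
Qed.

Lemma finv_trunc_stable D m N : q ^+ D.+1 = 0 -> (D <= N)%N ->
  rho (finv_trunc m.+1 N) = rho (finv_trunc m.+1 D).
Proof.
move=> qD le_DN; have KN := f_truncK m qD le_DN; have KD := f_truncK m qD (leqnn D).
rewrite -[LHS]mul1r -KD -[RHS]mul1r -KN (f_trunc_stable m qD le_DN); ring.
Qed.

Lemma rmorph_b_trunc N : rho (b_trunc N) =
  rho (f_trunc 2 N) ^+ 2 * rho (finv_trunc 1 N) * rho (finv_trunc 4 N) ^+ 3.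
Proof. by rewrite /b_trunc !(rmorphXn, rmorphM). Qed.
End Truncations.

Definition red3 : {rmorphism {poly int} -> {poly 'F_3}} :=
  GRing.RMorphism.clone _ _ (map_poly (intr : int -> 'F_3)) _.

Definition red3_mod D : {rmorphism {poly int} -> {poly %/ ('X^(D.+1) : {poly 'F_3})}} :=
  GRing.RMorphism.clone _ _ (in_qpoly ('X^(D.+1)) \o red3) _.

Lemma red3_modX D : red3_mod D 'X = in_qpoly ('X^(D.+1)) 'X.
Proof. by rewrite /= map_polyX. Qed.

(** Lets one polynomial with a common cut-off [N] serve several coefficients: the truncations at [n]
    and [N] agree modulo X^(n+1). *)
Lemma b_red3 n N : (n <= N)%N -> (b n)%:~R = (red3 (b_trunc N))`_n :> 'F_3.
Proof.
move=> le_nN; rewrite -[LHS](coef_map (intr : {rmorphism int -> 'F_3})).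
apply: (coef_in_qpoly (D := n)) => //.
rewrite -[LHS]/(red3_mod n (b_trunc n)) -[RHS]/(red3_mod n (b_trunc N)).
have qn : red3_mod n 'X ^+ n.+1 = 0 by rewrite red3_modX in_qpolyX_nil.
rewrite !rmorph_b_trunc.
by rewrite (f_trunc_stable 1 qn le_nN) !(finv_trunc_stable _ qn le_nN).
Qed.

(** [H] and [K] represent the series of b(9n+6) and b(9n+3). The bound is 3 (3n+2) + 2, as
    [coef_dissect] requires. *)
Lemma b_trunc_sections D : exists H K : {poly 'F_3}, forall n, (9 * n + 8 <= D)%N ->
  [/\ (red3 (b_trunc D))`_(9 * n + 3) = K`_n,
      (red3 (b_trunc D))`_(9 * n + 6) = H`_n,
      H`_(9 * n + 2) = - K`_n & H`_(9 * n + 5) = - H`_n].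
Proof.
pose px := red3 (f_trunc 1 D); pose pxi := red3 (finv_trunc 1 D).
pose py := red3 (f_trunc 2 D); pose pyi := red3 (finv_trunc 2 D).
pose pz := red3 (f_trunc 4 D); pose pzi := red3 (finv_trunc 4 D).
pose pi : {rmorphism {poly 'F_3} -> {poly %/ ('X^(D.+1) : {poly 'F_3})}} :=
  in_qpoly ('X^(D.+1)).
pose q := pi 'X.
have char3 : 3%N \in [pchar {poly %/ ('X^(D.+1) : {poly 'F_3})}].
  by rewrite pchar_qpoly pchar_Fp.
have qX : red3_mod D 'X = q by rewrite red3_modX.
have qD : red3_mod D 'X ^+ D.+1 = 0 by rewrite qX in_qpolyX_nil.
have xK : pi px * pi pxi = 1 := f_truncK 0 qD (leqnn D).
have yK : pi py * pi pyi = 1 := f_truncK 1 qD (leqnn D).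
have zK : pi pz * pi pzi = 1 := f_truncK 3 qD (leqnn D).
have fE m : eprod (-1) (q ^+ m) D = pi (red3 (f_trunc m D)).
  by rewrite -qX -rmorph_f_trunc.
have xE : eprod (-1) q D = pi px := fE 1%N.
rewrite qX in qD.
have := eprod_mod3 char3 qD; rewrite xE fE -/py => mod3_q.
have := eprod_mod3 char3 (expr_nilX 1 qD); rewrite -exprM !fE -/py -/pz => mod3_qq.
have NqD : (- q) ^+ D.+1 = 0 by rewrite exprNn qD mulr0.
have := eprod_mod3 char3 NqD; have := eprodN qD.
rewrite sqrrN xE !fE -/py -/pz => sE mod3_Nq.
have {sE} sE : eprod (-1) (- q) D = pi py ^+ 3 * pi pxi * pi pzi.
  by rewrite -sE; ring: xK zK.
rewrite sE mulNr in mod3_Nq.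
(* Polynomial representatives: the identities hold only after [pi], while coefficients are read
   here. *)
pose w := px * pz * pyi; pose phi := px ^+ 2 * pyi.
pose a := py ^+ 13 * pxi ^+ 5 * pzi ^+ 5; pose W := py ^+ 5 * pxi ^+ 2.
pose p3 := px ^+ 5 * pyi ^+ 2 * pzi.
pose H := phi * w ^+ 5; pose K := phi * a * w ^+ 2.
pose H2 := w * (phi ^+ 3 * w ^+ 6 + W * a * w ^+ 3).
have C1 : exists B C,
    pi (red3 (b_trunc D)) = pi (p3 ^+ 3 + 'X * B ^+ 3 + 'X^2 * C ^+ 3).
  exists (py ^+ 6 * pxi ^+ 3 * pzi), 0.
  rewrite -[LHS]/(red3_mod D _) rmorph_b_trunc.
  rewrite !(rmorphXn, rmorphM, rmorphD, rmorph0).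
  exact: b_dissect xK yK mod3_q.
have C2 : exists A,
    pi p3 = pi (A ^+ 3 + 'X * K ^+ 3 + 'X^2 * H ^+ 3).
  exists (phi * (py * pxi * pzi) * a ^+ 2).
  rewrite !(rmorphXn, rmorphM, rmorphD).
  exact: b_3n_dissect char3 xK yK zK mod3_Nq.
have C3 : exists A B, pi H = pi (A ^+ 3 + 'X * B ^+ 3 + 'X^2 * H2 ^+ 3).
  exists (w * (phi ^+ 3 * a ^+ 2 + 'X * W * w ^+ 6)),
    (w * (phi ^+ 3 * a * w ^+ 3 + W * a ^+ 2)).
  rewrite !(rmorphXn, rmorphM, rmorphD).
  exact: b_9n6_dissect char3 xK yK zK mod3_q mod3_Nq.
have C4 : exists C,
    pi H2 = pi ((- K) ^+ 3 + 'X * (- H) ^+ 3 + 'X^2 * C ^+ 3).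
  exists (w * py ^+ 6 * pxi ^+ 2 * pzi ^+ 2 * (pz ^+ 6 * pyi ^+ 3)).
  rewrite !(rmorphXn, rmorphN, rmorphM, rmorphD).
  exact: b_27n24_dissect char3 xK yK zK mod3_qq mod3_Nq.
exists H, K => n le_n.
have [B [C {}C1]] := C1; have [A {}C2] := C2.
have [A' [B' {}C3]] := C3; have [C' {}C4] := C4.
have [P2 P2' P2''] := coef_dissect C2 (n := n) ltac:(lia).
have [P1 _ _] := coef_dissect C1 (n := 3 * n + 1) ltac:(lia).
have [P1' _ _] := coef_dissect C1 (n := 3 * n + 2) ltac:(lia).
have [_ _ P3] := coef_dissect C3 (n := 3 * n) ltac:(lia).
have [_ _ P3'] := coef_dissect C3 (n := 3 * n + 1) ltac:(lia).
have [P4 P4' _] := coef_dissect C4 (n := n) ltac:(lia).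
split.
- by rewrite -P2' -P1; congr (_`__); lia.
- by rewrite -P2'' -P1'; congr (_`__); lia.
- by rewrite -coefN -P4 -P3; congr (_`__); lia.
- by rewrite -coefN -P4' -P3'; congr (_`__); lia.
Qed.

(** * Congruences modulo 3 *)

Lemma eqz_mod3 (m n : int) :
  m%:~R = n%:~R :> 'F_3 -> (m = n %[mod 3])%Z.
Proof.
move=> E; apply/eqP; rewrite eqz_mod_dvd.
by rewrite (dvdz_pcharf (pchar_Fp (isT : prime 3))) rmorphB /= E subrr.
Qed.

Lemma b_81n51 n : (b (81 * n + 51))%:~R = - (b (9 * n + 6))%:~R :> 'F_3.
Proof.
(* The cut-off is 9 (9n+5) + 8, the bound for the section at 9n+5. *)
have [H [K HK]] := b_trunc_sections (81 * n + 53).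
have [_ H1 _ H2] := HK n ltac:(lia); have [_ H3 _ _] := HK (9 * n + 5)%N ltac:(lia).
rewrite (@b_red3 (81 * n + 51) (81 * n + 53)) ?(@b_red3 (9 * n + 6) (81 * n + 53)); try lia.
by rewrite H1 -H2 -H3; congr (_`__); lia.
Qed.

Lemma b_81n24 n : (b (81 * n + 24))%:~R = - (b (9 * n + 3))%:~R :> 'F_3.
Proof.
have [H [K HK]] := b_trunc_sections (81 * n + 53).
have [H1 _ H2 _] := HK n ltac:(lia); have [_ H3 _ _] := HK (9 * n + 2)%N ltac:(lia).
rewrite (@b_red3 (81 * n + 24) (81 * n + 53)) ?(@b_red3 (9 * n + 3) (81 * n + 53)); try lia.
by rewrite H1 -H2 -H3; congr (_`__); lia.
Qed.

Theorem theorem1p2 :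
  (forall n k : nat,
      (b (3 ^ (2 * k.+1) * n + (5 * 3 ^ (2 * k.+1) + 3) %/ 8)%N
       = (-1) ^+ k * b (9 * n + 6)%N %[mod 3])%Z)
  /\
  (forall n : nat,
      (b (81 * n + 24)%N = - b (9 * n + 3)%N %[mod 3])%Z).
Proof.
split=> [n k|n]; apply: eqz_mod3; last by rewrite b_81n24 rmorphN.
elim: k => [|k IHk]; first by rewrite mul1r.
rewrite [in LHS]mulnS expnD -[(3 ^ 2)%N]/9%N.
(* The offset is 9e + 6, and raising [k] sends it to 81e + 51 = 9 (9e+5) + 6. With 3^(2(k+1)) = 9n',
   the step is thus [b_81n51] at [n' * n + e]. *)
have dvd8 : exists e, (5 * 3 ^ (2 * k.+1) + 3 = 8 * (9 * e + 6))%N.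
  elim: k {IHk} => [|k [e IHe]]; first by exists 0%N.
  by exists (9 * e + 5)%N; rewrite mulnS expnD; lia.
have [e eE] := dvd8; have [n' eP] : exists n', (3 ^ (2 * k.+1) = 9 * n')%N.
  by exists (3 ^ (2 * k))%N; rewrite mulnS expnD.
have := b_81n51 (n' * n + e).
have -> : (81 * (n' * n + e) + 51 =
    9 * 3 ^ (2 * k.+1) * n + (5 * (9 * 3 ^ (2 * k.+1)) + 3) %/ 8)%N.
  by rewrite eP; rewrite eP in eE; nia.
move=> ->; have -> : (9 * (n' * n + e) + 6 =
    3 ^ (2 * k.+1) * n + (5 * 3 ^ (2 * k.+1) + 3) %/ 8)%N.
  by rewrite eE mulKn // eP; nia.
by rewrite IHk exprS -rmorphN /= mulN1r mulNr.
Qed.
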